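(* Given the cost function $c$ used is the metric on the product space $\mathcal{Z}\times\mathcal{Y}$ : \begin{equation} \begin{split} W(\mathcal{P}^t, \mathcal{Q}^t) &\leq (1-\alpha)\operatorname{diam}(\mathcal{Z}\times\mathcal{Y})\sqrt{\frac{1}{2}\mathbb{E}_{z\sim\mathcal{P}_\mathcal{Z}}\left[KL\left(\mathcal{P}^t_{\mathcal{Y}|z}\,\middle\|\,\mathcal{P}^f_{\mathcal{Y}|z}\right)\right]} \\ &+ \sum\limits_{y\in\mathcal{Y}} \check{W}_{y}(\mathcal{P},\mathcal{Q}) + (1-\beta)\operatorname{diam}(\mathcal{Z}\times\mathcal{Y})\sqrt{\frac{1}{2}\mathbb{E}_{z\sim\mathcal{Q}_\mathcal{Z}}\left[KL\left(\mathcal{Q}^t_{\mathcal{Y}|z}\,\middle\|\,\mathcal{Q}^f_{\mathcal{Y}|z}\right)\right]} \end{split} \end{equation} with the subscripts being the marginal distributions.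
   Context: $\mathcal{Z}\subset\mathbb{R}^d$ is a compact measurable feature space and $\mathcal{Y}$ a finite label space; $\mathcal{P}^t,\mathcal{Q}^t$ are the true joint distributions on $\mathcal{Z}\times\mathcal{Y}$ of two domains. For a labeling function $f:\mathcal{Z}\to\mathcal{Y}$, $\mathcal{P}^f$ is the distribution of $(z,f(z))$ with $z\sim\mathcal{P}^t_\mathcal{Z}$; similarly $\mathcal{Q}^f$ denotes the estimated joint distribution of the second domain, i.e. of $(z,g(z))$ with $z\sim\mathcal{Q}^t_\mathcal{Z}$ for a labeling function $g$. The observed (partially labeled) distributions are the mixtures $\mathcal{P}=\alpha\mathcal{P}^t+(1-\alpha)\mathcal{P}^f$ and $\mathcal{Q}=\beta\mathcal{Q}^t+(1-\beta)\mathcal{Q}^f$ with $\alpha,\beta\in(0,1)$ the labeled fractions. All these distributions are assumed to admit densities. $W$ is the 1-Wasserstein distance with the Euclidean metric on $\mathcal{Z}\times\mathcal{Y}$ as cost; $\operatorname{diam}$ is the largest distance in the space; $KL(\mathcal{A}\|\mathcal{B})$ is the Kullback–Leibler divergence; and $\check{W}_{y}(\mathcal{P},\mathcal{Q}) = \sup_{\|\varphi_y\|_{Lip}\leq 1} \mathbb{E}_{z\sim\mathcal{P}_\mathcal{Z}}[\varphi_y(z,y)\mathcal{P}(Y=y|z)]-\mathbb{E}_{z\sim\mathcal{Q}_\mathcal{Z}}[\varphi_y(z,y)\mathcal{Q}(Y=y|z)]$. *)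

(* Defs.v *)
From mathcomp Require Import all_boot all_order all_algebra.
From mathcomp Require Import all_classical all_reals all_analysis.
Import numFieldNormedType.Exports.
Import Order.TTheory GRing.Theory Num.Theory.

Set Implicit Arguments.
Unset Strict Implicit.
Unset Printing Implicit Defensive.

Local Open Scope classical_set_scope.
Local Open Scope ring_scope.

Definition Euc (R : realType) (n : nat) := g_sigma_algebraType (@open 'rV[R]_n).

Section Defs.
Variables (R : realType) (d k : nat).
Local Notation X := (Euc R d).
Local Notation L := (Euc R k).

Definition ecost (p q : X * L) : R :=
  Num.sqrt (\sum_(i < d) (p.1 ord0 i - q.1 ord0 i) ^+ 2
          + \sum_(j < k) (p.2 ord0 j - q.2 ord0 j) ^+ 2).

Definition diamZY (Z : set X) (Ys : seq L) : \bar R :=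
  ereal_sup [set x | exists z z' y y', [/\ Z z, Z z', y \in Ys, y' \in Ys &
                     x = (ecost (z, y) (z', y'))%:E]].

(* A joint distribution on Z x Y is given by its density
   p : X -> L -> R w.r.t. (reference measure mu on X) x (counting on Y). *)
Definition is_density (mu : {measure set X -> \bar R}) (Z : set X) (Ys : seq L)
    (p : X -> L -> R) : Prop :=
  [/\ forall y, y \in Ys -> measurable_fun setT (fun z => p z y),
      forall z y, y \in Ys -> 0 <= p z y,
      forall z y, y \in Ys -> ~ Z z -> p z y = 0 &
      (\int[mu]_z (\sum_(y <- Ys) p z y)%:E = 1)%E].

Definition marg (Ys : seq L) (p : X -> L -> R) (z : X) : R := \sum_(y <- Ys) p z y.

Definition cond (Ys : seq L) (p : X -> L -> R) (z : X) (y : L) : R :=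
  p z y / marg Ys p z.

(* density of the distribution of (z, f z) with z drawn from the marginal of p *)
Definition labdens (Ys : seq L) (p : X -> L -> R) (f : X -> L) (z : X) (y : L) : R :=
  marg Ys p z * (f z == y)%:R.

Definition mix (a : R) (p1 p2 : X -> L -> R) (z : X) (y : L) : R :=
  a * p1 z y + (1 - a) * p2 z y.

Definition klterm (a b : R) : \bar R :=
  if a == 0 then 0%E else if b == 0 then +oo%E else (a * ln (a / b))%:E.
Definition KLfin (Ys : seq L) (P Q : L -> R) : \bar R :=
  (\sum_(y <- Ys) klterm (P y) (Q y))%E.

Definition EZ (mu : {measure set X -> \bar R}) (Z : set X) (Ys : seq L)
    (p : X -> L -> R) (h : X -> \bar R) : \bar R :=
  (\int[mu]_(z in Z) ((marg Ys p z)%:E * h z))%E.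

Definition lip1 (Z : set X) (Ys : seq L) (phi : X -> L -> R) : Prop :=
  forall z z' y y', Z z -> Z z' -> y \in Ys -> y' \in Ys ->
    `|phi z y - phi z' y'| <= ecost (z, y) (z', y').

Definition Wcheck (mu : {measure set X -> \bar R}) (Z : set X) (Ys : seq L)
    (p q : X -> L -> R) (y : L) : \bar R :=
  ereal_sup [set x | exists phi, lip1 Z Ys phi /\
    x = (EZ mu Z Ys p (fun z => (phi z y * cond Ys p z y)%:E)
       - EZ mu Z Ys q (fun z => (phi z y * cond Ys q z y)%:E))%E].

Definition jointm (mu : {measure set X -> \bar R}) (Ys : seq L) (p : X -> L -> R)
    (A : set (X * L)) : \bar R :=
  (\int[mu]_z (\sum_(y <- Ys) \1_A (z, y) * p z y)%:E)%E.

Definition W1 (mu : {measure set X -> \bar R}) (Ys : seq L) (p q : X -> L -> R)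
    : \bar R :=
  ereal_inf [set x | exists pi : probability ((X * L) * (X * L))%type R,
    (forall A : set (X * L), measurable A ->
       pi (A `*` setT) = jointm mu Ys p A /\ pi (setT `*` A) = jointm mu Ys q A)
    /\ x = (\int[pi]_w (ecost w.1 w.2)%:E)%E].

End Defs.

(* Main.v *)
(* Labels given by f are deterministic, so KL(Pt(.|z) || Pf(.|z)) is 0 when
   Pt(.|z) is the point mass at f z and +oo otherwise. Hence each KL term is
   either +oo, and the bound is trivial, or 0, and then pt equals its mixture P
   almost everywhere. What remains is W1 P Q <= sum_y Wcheck_y P Q, which follows
   from Kantorovich duality on Z x Y: cut Z into small cells, solve the finite
   transport problem between the cell masses by Farkas' lemma, and spread the
   optimal plan over products of cells. A dual pair (u, v) of the finite problem
   yields the 1-Lipschitz function phi w = min_j (v_j + c w w_j), which lies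
   between u_i and v_i, up to the cell diameter, on the i-th cell; the same phi
   is admissible for every label y. *)

From HB Require Import structures.
Require Import Defs.
From mathcomp Require Import all_boot all_order all_algebra.
From mathcomp Require Import all_classical all_reals all_analysis.
From mathcomp Require Import measurable_realfun ring lra.
Import numFieldNormedType.Exports.
Import Order.TTheory GRing.Theory Num.Theory.
Local Open Scope classical_set_scope.
Local Open Scope ring_scope.

(** * Farkas' lemma and finite transport duality *)

(** Induction on the number of forms. Either the last constraint is redundant and gets coefficient
    0, or some [x0] violates the claim without it, and projecting along [x0] eliminates the last
    form. The argument is purely algebraic, so [V] needs neither a dimension bound nor a
    topology. *)
Lemma farkas (F : realFieldType) (V : lmodType F) (n : nat)
    (a : 'I_n -> V -> F) (b : V -> F) :
  (forall i, scalar (a i)) -> scalar b ->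
  (forall x, (forall i, a i x <= 0) -> b x <= 0) ->
  exists2 l : 'I_n -> F, (forall i, 0 <= l i) &
    forall x, b x = \sum_i l i * a i x.
Proof.
elim: n a b => [|n IH] a b la lb ab.
  (* With no constraint both [x] and [- x] are feasible, which forces [b x = 0]. *)
  exists (fun=> 0) => // x; rewrite big_ord0; apply/eqP.
  have bN : b (- x) = - b x.
    have := lb (-1) x 0; rewrite addr0 scaleN1r => ->.
    have := lb (-1) 0 0; rewrite scaleN1r oppr0 addr0 => b0; lra.
  have h1 : b (- x) <= 0 by apply: ab => -[].
  have h2 : b x <= 0 by apply: ab => -[].
  by rewrite eq_le h2 -oppr_le0 -bN.
have wE i : widen_ord (leqnSn n) i = lift ord_max i.
  by apply/val_inj; rewrite /= /bump leqNgt ltn_ord.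
pose a' i := a (widen_ord (leqnSn n) i); pose am := a ord_max.
have E (l : 'I_n -> F) l0 x :
    \sum_(i < n.+1) (if unlift ord_max i is Some j then l j else l0) * a i x
    = \sum_i l i * a' i x + l0 * am x.
  rewrite big_ord_recr /= unlift_none; congr (_ + _); apply: eq_bigr => i _.
  by rewrite /a' wE liftK.
have [h|/existsNP[x0 /not_implyP[ax0 /negP]]] :=
    pselect (forall x, (forall i, a' i x <= 0) -> b x <= 0).
  have [l l0 bl] := IH a' b (fun i => la _) lb h.
  exists (fun i => if unlift ord_max i is Some j then l j else 0).
    by move=> i; case: unlift.
  by move=> x; rewrite E mul0r addr0.
rewrite -ltNge => bx0.
have amx0 : 0 < am x0.
  rewrite ltNge; apply/negP => am0; suff : b x0 <= 0 by rewrite leNgt bx0.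
  apply: ab => i; have [j ->|->//] := unliftP ord_max i.
  by have := ax0 j; rewrite /a' wE.
have lin k (h : V -> F) u v : scalar h -> h (k *: u + v) = k * h u + h v.
  by move=> ->.
(* Only the last form is positive at [x0]: project all forms along [x0] onto its kernel. *)
pose P (h : V -> F) x := h x - h x0 / am x0 * am x.
have lP h : scalar h -> scalar (P h).
  by move=> lh k u v; rewrite /P (lin _ _ _ _ lh) (lin _ am _ _ (la ord_max)) /=; ring.
have Pproj h x : scalar h -> P h x = h (- (am x / am x0) *: x0 + x).
  by move=> lh; rewrite (lin _ _ _ _ lh) /P; field; rewrite gt_eqF.
have [x Px|l l0 bl] := IH (fun i => P (a' i)) (P b) (fun i => lP _ (la _)) (lP _ lb).
  rewrite Pproj//; apply: ab => i; have [j ->|->] := unliftP ord_max i.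
    by have := Px j; rewrite Pproj ?/a' ?wE//; exact: la.
  rewrite -/am (lin _ am _ _ (la ord_max)) le_eqVlt; apply/orP; left; apply/eqP.
  by field; rewrite gt_eqF.
(* The last coefficient is forced by evaluating the identity at [x0]; it is nonnegative because
   [b x0 > 0] and every [a' i x0 <= 0]. *)
exists (fun i => if unlift ord_max i is Some j then l j
                 else (b x0 - \sum_i l i * a' i x0) / am x0).
  move=> i; case: unlift => //; apply: divr_ge0; last exact: ltW.
  rewrite subr_ge0 (le_trans _ (ltW bx0))//; apply: sumr_le0 => j _.
  by rewrite mulr_ge0_le0.
move=> x; rewrite E; have := bl x; rewrite /P.
under eq_bigr => i _ do rewrite mulrBr mulrA mulrA.
rewrite sumrB -mulr_suml -mulr_suml => /eqP; rewrite subr_eq => /eqP ->; ring.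
Qed.

(** Farkas' lemma for the homogenised dual program in [(u, v, t)], with constraints
    [u i - v j <= t * c i j] and [0 <= t]. The multipliers of the first family form the plan, and
    the multiplier of [0 <= t] is the slack in the cost bound. *)
Lemma finite_kantorovich (F : realFieldType) (I : finType) (c : I -> I -> F)
    (p q : I -> F) (D : F) :
  (forall i j, 0 <= c i j) ->
  (forall u v : I -> F, (forall i j, u i - v j <= c i j) ->
     \sum_i u i * p i - \sum_i v i * q i <= D) ->
  exists l : I -> I -> F, [/\ forall i j, 0 <= l i j,
    forall i, \sum_j l i j = p i, forall j, \sum_i l i j = q j &
    \sum_i \sum_j l i j * c i j <= D].
Proof.
move=> c0 dual.
pose V := ({ffun I -> F^o} * {ffun I -> F^o} * F^o)%type.
pose A (o : option (I * I)) (x : V) : F :=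
  if o is Some ij then x.1.1 ij.1 - x.1.2 ij.2 - x.2 * c ij.1 ij.2 else - x.2.
pose b (x : V) : F := \sum_i x.1.1 i * p i - \sum_i x.1.2 i * q i - x.2 * D.
have lA o : scalar (A o).
  move=> k [[u v] t] [[u' v'] t']; case: o => [[i j]|] /=; rewrite /A /=.
    by rewrite !ffunE /GRing.scale /=; ring.
  by rewrite /GRing.scale /=; ring.
have lb : scalar b.
  move=> k [[u v] t] [[u' v'] t']; rewrite /b /=.
  under eq_bigr => i _ do rewrite !ffunE mulrDl -mulrA.
  rewrite big_split /= -mulr_sumr.
  under [X in _ - X - _]eq_bigr => i _ do rewrite !ffunE mulrDl -mulrA.
  rewrite big_split /= -mulr_sumr /GRing.scale /=; ring.
have [[[u v] t] Ax|l l0 bl] :=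
    farkas _ V #|{: option (I * I)}| (fun k => A (enum_val k)) b (fun=> lA _) lb.
  have {}Ax o : A o (u, v, t) <= 0 by have := Ax (enum_rank o); rewrite enum_rankK.
  have t0 : 0 <= t by have := Ax None; rewrite /A /= oppr_le0.
  have uv i j : u i - v j <= t * c i j by have := Ax (Some (i, j)); rewrite /A /= subr_le0.
  rewrite /b /= subr_le0; move: t0; rewrite le_eqVlt => /predU1P[t0|t0].
    (* [(u, v)] is a recession direction of the dual: a large multiple of it would exceed [D]. *)
    rewrite -t0 mul0r leNgt; apply/negP => pos.
    set S := _ - _ in pos.
    have D0 : 0 <= D.
      have := dual (fun=> 0) (fun=> 0).
      rewrite subr0 !big1 ?subr0; [|by move=> *; rewrite mul0r..].
      by apply=> i j; exact: c0.
    have : (D + 1) / S * S <= D.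
      rewrite mulrBr !mulr_sumr.
      under eq_bigr => i _ do rewrite mulrA.
      under [X in _ - X]eq_bigr => i _ do rewrite mulrA.
      apply: (dual (fun i => (D + 1) / S * u i) (fun i => (D + 1) / S * v i)) => i j.
      rewrite -mulrBr (le_trans _ (c0 i j))// mulr_ge0_le0//.
        by rewrite divr_ge0 ?ltW//; lra.
      by have := uv i j; rewrite -t0 mul0r.
    by rewrite divfK ?gt_eqF//; lra.
  (* For [t > 0] dividing by [t] gives a feasible dual pair. *)
  have : t^-1 * (\sum_i u i * p i - \sum_i v i * q i) <= D.
    rewrite mulrBr !mulr_sumr.
    under eq_bigr => i _ do rewrite mulrA.
    under [X in _ - X]eq_bigr => i _ do rewrite mulrA.
    apply: (dual (fun i => t^-1 * u i) (fun i => t^-1 * v i)) => i j.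
    by rewrite -mulrBr ler_pdivrMl.
  by rewrite ler_pdivrMl.
have {}bl x : b x = \sum_i \sum_j l (enum_rank (Some (i, j))) * A (Some (i, j)) x
                    - l (enum_rank None) * x.2.
  rewrite bl (reindex enum_rank) /=; last exact: onW_bij (enum_rank_bij _).
  under eq_bigr => o _ do rewrite enum_rankK.
  rewrite (bigD1 None) //= addrC mulrN pair_bigA /=; congr (_ - _).
  rewrite (reindex_omap Some id) /=; last by case.
  by apply: eq_big => [[i j]|[i j] _]; rewrite ?eqxx.
exists (fun i j => l (enum_rank (Some (i, j)))); split => //.
(* The marginals of the plan are read off by testing the identity on unit vectors in [u], then in
   [v]. *)
- move=> i; have := bl ([ffun k => (k == i)%:R], [ffun=> 0], 0).
  rewrite /b /A /= mul0r mulr0 !subr0.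
  rewrite (bigD1 i) //= ffunE eqxx mul1r big1 ?addr0; last first.
    by move=> k /negPf ki; rewrite ffunE ki mul0r.
  rewrite [X in p i - X]big1 ?subr0; last by move=> k _; rewrite ffunE mul0r.
  move=> ->; rewrite [RHS](bigD1 i) //= [X in _ = _ + X]big1 ?addr0; last first.
    by move=> k /negPf ki; rewrite big1 // => j _; rewrite !ffunE ki mul0r !subr0 mulr0.
  by apply: eq_bigr => j _; rewrite !ffunE eqxx mul0r !subr0 mulr1.
- move=> j; have := bl ([ffun=> 0], [ffun k => (k == j)%:R], 0).
  rewrite /b /A /= mul0r mulr0 !subr0.
  rewrite [X in X - _]big1; last by move=> k _; rewrite ffunE mul0r.
  rewrite (bigD1 j) //= ffunE eqxx mul1r big1 ?addr0; last first.
    by move=> k /negPf ki; rewrite ffunE ki mul0r.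
  rewrite sub0r => /eqP; rewrite eqr_oppLR => /eqP ->; rewrite -sumrN; apply: eq_bigr => i _.
  rewrite [in RHS](bigD1 j) //= [X in _ + X]big1 ?addr0; last first.
    by move=> k /negPf ki; rewrite !ffunE ki mul0r !subr0 mulr0.
  by rewrite !ffunE eqxx mul0r subr0 sub0r mulrN1 opprK.
(* At [(0, 0, 1)] the identity says that the cost of the plan plus the multiplier of [0 <= t] equals
   [D]. *)
- have := bl ([ffun=> 0], [ffun=> 0], 1); rewrite /b /A /= mul1r mulr1.
  rewrite [X in X - _ - _]big1; last by move=> k _; rewrite ffunE mul0r.
  rewrite [X in _ - X - _]big1; last by move=> k _; rewrite ffunE mul0r.
  rewrite subr0.
  under eq_bigr => i _.
    under eq_bigr => j _ do rewrite !ffunE mul1r subrr sub0r mulrN.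
    rewrite sumrN; over.
  rewrite sumrN sub0r => /eqP; rewrite eqr_oppLR opprD !opprK => /eqP ->.
  by rewrite lerDl.
Qed.

(** * Partitions, finite mixtures and couplings of probability measures *)

Lemma measure_trivIset_seq d (T : measurableType d) (R : realType)
    (m : {measure set T -> \bar R}) (I : eqType) (s : seq I) (A : I -> set T)
    (B : set T) :
  uniq s -> measurable B -> (forall i, measurable (A i)) -> trivIset setT A ->
  m (B `&` \big[setU/set0]_(i <- s) A i) = (\sum_(i <- s) m (B `&` A i))%E.
Proof.
move=> + mB mA tA; elim: s => [|i s IH] /=; first by rewrite !big_nil setI0 measure0.
move=> /andP[si us]; rewrite !big_cons setIUr measureU /=.
- by congr (_ + _)%E; exact: IH.
- exact: measurableI.
- by apply: measurableI => //; exact: bigsetU_measurable.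
- rewrite setIACA setIid big_distrr /= big_seq big1 ?setI0// => j js.
  move/trivIsetP : tA => -> //; apply/eqP => ij; move: si; rewrite ij js//.
Qed.

Lemma probability_partition d (T : measurableType d) (R : realType)
    (P : probability T R) (I : finType) (A : I -> set T) (K B : set T) :
  (forall i, measurable (A i)) -> trivIset setT A ->
  measurable K -> P (~` K) = 0%E -> (forall x, K x -> exists i, A i x) ->
  measurable B -> P B = (\sum_i P (B `&` A i))%E.
Proof.
move=> mA tA mK PK KA mB.
rewrite -(measure_trivIset_seq _ _ _ P _ _ A B (index_enum_uniq I) mB mA tA).
have mU : measurable (\big[setU/set0]_i A i) by exact: bigsetU_measurable.
rewrite (measureDI P mB mU) [X in (X + _)%E](_ : _ = 0%E) ?add0e//.
apply: (subset_measure0 _ _ _ PK) => //; [exact: measurableD|exact: measurableC|].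
move=> x [_ nx] Kx; apply: nx; have [i Ai] := KA _ Kx.
by rewrite (bigD1 i) //=; left.
Qed.

Lemma measure1_probability d (T : measurableType d) (R : realType)
    (m : {measure set T -> \bar R}) :
  m setT = 1%E -> exists P : probability T R, P = m :> (set T -> \bar R).
Proof.
(* Normalising a measure of mass one changes nothing but supplies the probability structure;
   [dirac point] is the fallback for mass 0 or [+oo] and is never reached. *)
move=> m1; exists (mnormalize m (dirac point)); apply/funext => A.
by rewrite /= /mnormalize m1 onee_eq0 /= invr1 mule1.
Qed.

Lemma finite_mixture d (T : measurableType d) (R : realType) (I : finType)
    (l : I -> R) (m : I -> probability T R) :
  (forall i, 0 <= l i) -> \sum_i l i = 1 ->
  exists P : probability T R,
    (forall A, P A = \sum_i (l i)%:E * m i A)%E /\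
    (forall f : T -> \bar R, measurable_fun setT f -> (forall x, 0 <= f x)%E ->
      \int[P]_x f x = \sum_i (l i)%:E * \int[m i]_x f x)%E.
Proof.
move=> l0 l1.
(* [msum] is indexed by naturals, so [I] is enumerated through [nth], whose default value must be an
   element of [I]; weights of total 1 provide one. *)
have [i0 _] : exists i : I, true.
  apply/existsP; apply: contraT => /existsPn nI.
  move: l1; rewrite big1 => [/eqP|i _]; first by rewrite eq_sym oner_eq0.
  by have := nI i.
pose mm n : {measure set T -> \bar R} :=
  mscale (NngNum (l0 (nth i0 (index_enum I) n))) (m (nth i0 (index_enum I) n)).
have sumE (F : I -> \bar R) :
    (\sum_i F i = \sum_(k < size (index_enum I)) F (nth i0 (index_enum I) k))%E.
  by rewrite (big_nth i0) big_mkord.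
have [|P PE] := measure1_probability _ T R (msum mm (size (index_enum I))).
  rewrite /= /msum -(sumE (fun i => (l i)%:E * m i setT)%E).
  under eq_bigr => i _ do rewrite probability_setT mule1.
  by rewrite sumEFin l1.
exists P; split=> [A|f mf f0]; first by rewrite PE /= /msum sumE.
rewrite PE ge0_integral_measure_sum//= sumE; apply: eq_bigr => k _.
by rewrite ge0_integral_mscale.
Qed.

(** The coupling is the mixture, with weights [l i j], of the products of [P] conditioned on [A i]
    and [Q] conditioned on [A j]. The row and column sums of [l] are the cell masses, so
    conditioning is undone in each marginal. *)
Lemma coupling_of_plan d (T : measurableType d) (R : realType)
    (P Q : probability T R) (I : finType) (A : I -> set T) (K : set T)
    (l b : I -> I -> R) (c : T * T -> R) :
  (forall i, measurable (A i)) -> trivIset setT A ->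
  measurable K -> P (~` K) = 0%E -> Q (~` K) = 0%E ->
  (forall x, K x -> exists i, A i x) ->
  (forall i j, 0 <= l i j) ->
  (forall i, (\sum_j l i j)%:E = P (A i)) ->
  (forall j, (\sum_i l i j)%:E = Q (A j)) ->
  measurable_fun setT c -> (forall w, 0 <= c w) ->
  (forall i j, 0 <= b i j) ->
  (forall i j x y, A i x -> A j y -> c (x, y) <= b i j) ->
  exists pi : probability (T * T)%type R,
    (forall B, measurable B -> pi (B `*` setT) = P B /\ pi (setT `*` B) = Q B) /\
    (\int[pi]_w (c w)%:E <= (\sum_i \sum_j l i j * b i j)%:E)%E.
Proof.
move=> mA tA mK PK QK KA l0 lP lQ mc c0 b0 cb.
(* If [M (A i) = 0] then [N M i] is the junk value [M], but the weight [l] vanishes there. *)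
pose N (M : probability T R) i : probability T R := mnormalize (mrestr M (mA i)) M.
have NE (M : probability T R) i B : measurable B -> (M (A i) * N M i B = M (B `&` A i))%E.
  move=> mB.
  have -> : N M i B = (if (M (A i) == 0) || (M (A i) == +oo) then M B
                       else M (B `&` A i) * (fine (M (A i)))^-1%:E)%E.
    rewrite -{1 2 4}(setTI (A i)) /N /= /mnormalize /mrestr.
    by case: (_ || _).
  have Mfin : M (A i) \is a fin_num by exact: fin_num_measure.
  case: ifPn => [/orP[/eqP M0|/eqP My]|].
  - rewrite M0 mul0e; apply/esym/(subset_measure0 _ _ _ M0) => //; exact: measurableI.
  - by rewrite My in Mfin.
  - rewrite negb_or => /andP[M0 _]; rewrite muleCA -{1}(fineK Mfin) -EFinM.
    by rewrite mulfV ?mule1// fine_eq0.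
have NA (M : probability T R) i : M (A i) != 0%E -> N M i (~` A i) = 0%E.
  move=> M0; have := NE M i (~` A i) (measurableC (mA i)).
  by rewrite setICl measure0 => /eqP; rewrite mule_eq0 (negPf M0) => /eqP.
have NT (M : probability T R) i : N M i setT = 1%E by exact: probability_setT.
have XE i j B C : measurable B -> measurable C ->
    ((N P i \x N Q j) (B `*` C) = N P i B * N Q j C)%E.
  by move=> mB mC; exact: product_measure1E.
have pP (i : I * I) : exists M : probability (T * T)%type R, M = (N P i.1 \x N Q i.2)%E :> (set _ -> \bar R).
  have : (N P i.1 \x N Q i.2)%E setT = 1%E by rewrite -setXTT XE// !NT mule1.
  exact: (measure1_probability _ _ _ (N P i.1 \x N Q i.2)%E).
have [M ME] := choice pP.
have lsum : \sum_i l i.1 i.2 = 1.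
  rewrite -(pair_bigA _ l) /=; apply: EFin_inj; rewrite -sumEFin.
  under eq_bigr => i _ do rewrite lP -(setTI (A i)).
  by rewrite -(probability_partition _ _ _ _ _ _ K)// probability_setT.
have [pi [piE piint]] := finite_mixture _ _ _ _ (fun i => l i.1 i.2) M
  (fun i => l0 i.1 i.2) lsum.
have l_eq0 i j : P (A i) = 0%E \/ Q (A j) = 0%E -> l i j = 0.
  rewrite -lP -lQ => -[] [] /eqP.
    by rewrite psumr_eq0// => /allP/(_ j)/(_ (mem_index_enum _))/eqP.
  by rewrite psumr_eq0// => /allP/(_ i)/(_ (mem_index_enum _))/eqP.
exists pi; split.
  move=> B mB; split; rewrite piE.
    under eq_bigr => i _.
      rewrite ME XE// NT mule1; over.
    rewrite -(pair_bigA _ (fun i j => (l i j)%:E * N P i B)%E) /=.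
    rewrite (probability_partition _ _ _ P _ A K B)//; apply: eq_bigr => i _.
    rewrite -NE// -lP -sumEFin ge0_sume_distrl// => j _.
    by rewrite lee_fin.
  under eq_bigr => i _.
    rewrite ME XE// NT mul1e; over.
  rewrite -(pair_bigA _ (fun i j => (l i j)%:E * N Q j B)%E) /= exchange_big /=.
  rewrite (probability_partition _ _ _ Q _ A K B)//; apply: eq_bigr => i _.
  rewrite -NE// -lQ -sumEFin ge0_sume_distrl// => j _.
  by rewrite lee_fin.
rewrite piint; [|exact/measurable_EFinP|by move=> w; rewrite lee_fin].
rewrite pair_bigA /= -sumEFin; apply: lee_sum => -[i j] _ /=.
(* Pairs involving a null cell carry no weight, so only genuine conditional laws remain. *)
have [Pi0|Pi0] := eqVneq (P (A i)) 0%E; first by rewrite l_eq0 ?mul0e ?mul0r//; left.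
have [Qj0|Qj0] := eqVneq (Q (A j)) 0%E; first by rewrite l_eq0 ?mul0e ?mul0r//; right.
rewrite EFinM lee_wpmul2l ?lee_fin//.
have -> : (b i j)%:E = (\int[M (i, j)]_w cst (b i j)%:E w)%E.
  have MT : M (i, j) setT = 1%E by exact: probability_setT.
  by rewrite -[LHS]mule1 -MT; apply/esym; exact: integral_cst.
apply: ae_ge0_le_integral => //.
- by move=> w _; rewrite lee_fin.
- exact/measurable_EFinP.
- by move=> w _; rewrite lee_fin.
(* The bound by [b i j] can fail only off the product of the two cells, a null set for the product
   of laws carried by them. *)
exists ((~` A i `*` setT) `|` (setT `*` ~` A j)); split.
- by apply: measurableU; apply: measurableX => //; exact: measurableC.
- have mAC k : measurable (~` A k) by exact: measurableC.
  have Z1 : M (i, j) (~` A i `*` setT) = 0%E by rewrite ME XE//= NA// mul0e.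
  have Z2 : M (i, j) (setT `*` ~` A j) = 0%E by rewrite ME XE//= NA// mule0.
  by apply: null_set_setU => //; exact: measurableX.
- move=> [x y] /= /not_implyP[_ /negP]; rewrite lee_fin => nc.
  have [Ax|nAx] := pselect (A i x); [right|by left].
  by split => // Ay; rewrite cb in nc.
Qed.

(** * Measurability of the cost and of label sets *)

Lemma measurable_sum_seq d (T : measurableType d) (R : realType) (D : set T)
    (I : eqType) (s : seq I) (h : I -> T -> R) :
  (forall i, i \in s -> measurable_fun D (h i)) ->
  measurable_fun D (fun x => \sum_(i <- s) h i x).
Proof.
(* Terms with index outside [s] are replaced by 0, since [measurable_sum] asks for measurability at
   every index. *)
move=> mh; have -> : (fun x => \sum_(i <- s) h i x) =
    (fun x => \sum_(i <- s) (if i \in s then h i x else 0)).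
  by rewrite funeqE => x; apply: eq_big_seq => i is_; rewrite is_.
apply: measurable_sum => i.
by case: (boolP (i \in s)) => [/mh //|_]; exact: measurable_cst.
Qed.

Lemma measurable_coord (R : realType) (n : nat) (i : 'I_n) :
  measurable_fun setT (fun z : Euc R n => z ord0 i).
Proof.
apply: (measurability _ (RGenOInfty.measurableE R)) => //.
move=> _ [_ [x ->] <-]; apply: sub_sigma_algebra; rewrite setTI.
apply: (@open_comp _ _ (fun z : 'rV[R]_n => z ord0 i)) => [z _|].
  exact: coord_continuous.
by rewrite set_itvE; exact: open_gt.
Qed.

Lemma measurable_sqdist d (T : measurableType d) (R : realType) (n : nat)
    (f g : T -> Euc R n) :
  measurable_fun setT f -> measurable_fun setT g ->
  measurable_fun setT (fun x => \sum_(i < n) (f x ord0 i - g x ord0 i) ^+ 2).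
Proof.
move=> mf mg; apply: measurable_sum => i; apply: measurable_funX.
by apply: measurable_funB; apply: (measurableT_comp (measurable_coord R n i)).
Qed.

Lemma measurable_sqrt (R : realType) : measurable_fun setT (@Num.sqrt R).
Proof. by apply: continuous_measurable_fun; exact: sqrt_continuous. Qed.

Lemma measurable_ecost d (T : measurableType d) (R : realType) (m n : nat)
    (f g : T -> Euc R m * Euc R n) :
  measurable_fun setT f -> measurable_fun setT g ->
  measurable_fun setT (fun x => ecost (f x) (g x)).
Proof.
move=> mf mg; apply: (measurableT_comp (measurable_sqrt R)).
apply: measurable_funD; apply: measurable_sqdist.
- exact: (measurableT_comp measurable_fst mf).
- exact: (measurableT_comp measurable_fst mg).
- exact: (measurableT_comp measurable_snd mf).
- exact: (measurableT_comp measurable_snd mg).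
Qed.

(** The fibre over [y] is the zero set of the squared distance to [y], a measurable real
    function. *)
Lemma measurable_eqEuc d (T : measurableType d) (R : realType) (n : nat)
    (f : T -> Euc R n) (y : Euc R n) :
  measurable_fun setT f -> measurable [set x | f x = y].
Proof.
move=> mf; have := measurable_sqdist _ _ _ _ f (cst y) mf (measurable_cst _).
move=> /(_ measurableT [set 0] (measurable_set1 _)); rewrite setTI.
congr (measurable _); apply/seteqP; split => x /=.
  move=> /eqP; rewrite psumr_eq0 => [/allP h|i _]; last exact: sqr_ge0.
  apply/rowP => i; have := h i (mem_index_enum _).
  by rewrite sqrf_eq0 subr_eq0 => /eqP.
by move=> ->; rewrite big1// => i _; rewrite subrr expr0n.
Qed.

Lemma measurable_seq (R : realType) (n : nat) (s : seq (Euc R n)) :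
  measurable [set` s].
Proof.
elim: s => [|y s IH]; first by rewrite set_nil.
rewrite (_ : [set` _] = [set x | x = y] `|` [set` s]); last first.
  apply/seteqP; split => x /=; rewrite inE; first by case/predU1P; [left|right].
  by case=> [->|->]; rewrite ?eqxx ?orbT.
apply: measurableU => //.
exact: (measurable_eqEuc _ _ _ _ id y (@measurable_id _ _ _)).
Qed.

(** * The joint distribution of a density as a probability measure *)

Section JointMeasure.
Variables (R : realType) (d k : nat) (Z : set (Euc R d)) (Ys : seq (Euc R k)).
Variables (mu : {measure set (Euc R d) -> \bar R}) (p : Euc R d -> Euc R k -> R).
Variable dens : is_density mu Z Ys p.

(* The proof argument is what lets [jointm] carry a measure instance. *)
Definition density_measure (_ : is_density mu Z Ys p) := jointm mu Ys p.

Lemma measurable_jointm_integrand (A : set (Euc R d * Euc R k)) : measurable A ->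
  measurable_fun setT (fun z => \sum_(y <- Ys) \1_A (z, y) * p z y).
Proof.
move=> mA; case: dens => mp _ _ _.
apply: measurable_sum_seq => y yY; apply: measurable_funM; last exact: mp.
apply: (measurableT_comp (measurable_indic mA)).
apply: (@measurable_fun_pair _ _ _ _ _ _ id (cst y)).
  exact: measurable_id.
exact: measurable_cst.
Qed.

Lemma jointm_integrand_ge0 (A : set (Euc R d * Euc R k)) z :
  0 <= \sum_(y <- Ys) \1_A (z, y) * p z y.
Proof.
case: dens => _ p0 _ _; rewrite big_seq; apply: sumr_ge0 => y yY.
by rewrite mulr_ge0// p0.
Qed.

Let mu0 : density_measure dens set0 = 0%E.
Proof.
by apply: integral0_eq => z _; rewrite big1// => y _; rewrite indic0 mul0r.
Qed.

Let mu_ge0 A : (0 <= density_measure dens A)%E.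
Proof. by apply: integral_ge0 => z _; rewrite lee_fin jointm_integrand_ge0. Qed.

Let mu_sigma_additive : semi_sigma_additive (density_measure dens).
Proof.
move=> F mF tF mUF.
rewrite [X in _ --> X](_ : _ = \sum_(n <oo) density_measure dens (F n))%E; last first.
  rewrite /density_measure /jointm -integral_nneseries//; last 2 first.
  - by move=> n; apply/measurable_EFinP; exact: measurable_jointm_integrand.
  - by move=> n z _; rewrite lee_fin jointm_integrand_ge0.
  apply: eq_integral => z _.
  pose ys : nat -> Euc R k := nth point Ys.
  (* For fixed [z] the integrand, as a function of the set, is a finite sum of weighted Dirac
     masses, hence itself a measure. The norm only provides the nonnegativity that [NngNum]
     requires. *)
  pose m : {measure set (Euc R d * Euc R k) -> \bar R} :=
    msum (fun i => mscale (NngNum (normr_ge0 (p z (ys i))))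
                          (dirac ((z, ys i) : Euc R d * Euc R k))) (size Ys).
  have mE A : (\sum_(y <- Ys) \1_A (z, y) * p z y)%:E = m A.
    rewrite /m /= /msum (big_nth point) big_mkord -sumEFin; apply: eq_bigr => i _.
    rewrite /= /mscale /= diracE -indicE -EFinM mulrC ger0_norm//.
    by case: dens => _ p0 _ _; rewrite p0// mem_nth.
  rewrite mE; under eq_eseriesr => n _ do rewrite mE.
  exact: measure_semi_bigcup.
by apply/cvg_closeP; split; [exact: is_cvg_nneseries|rewrite closeE].
Qed.

HB.instance Definition _ := isMeasure.Build _ _ _ (density_measure dens)
  mu0 mu_ge0 mu_sigma_additive.

Lemma jointm_probability :
  exists P : probability (Euc R d * Euc R k)%type R,
    P = jointm mu Ys p :> (set _ -> \bar R).
Proof.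
apply: (measure1_probability _ _ _ (density_measure dens)).
rewrite /= /density_measure /jointm; case: dens => _ _ _ <-.
apply: eq_integral => z _; congr _%:E; apply: eq_bigr => y _.
by rewrite indicT mul1r.
Qed.

Lemma jointm_outside : jointm mu Ys p (~` (Z `*` [set` Ys])) = 0%E.
Proof.
case: dens => _ _ p0 _; apply: integral0_eq => z _; rewrite big_seq big1// => y yY.
have [Zz|nZz] := pselect (Z z); last by rewrite p0// mulr0.
by rewrite indicE memNset ?mul0r//; apply.
Qed.

Lemma jointm_slice (B : set (Euc R d)) (y : Euc R k) : uniq Ys -> y \in Ys ->
  jointm mu Ys p (B `*` [set y]) = (\int[mu]_z (\1_B z * p z y)%:E)%E.
Proof.
move=> uY yY; apply: eq_integral => z _; congr _%:E.
rewrite (bigD1_seq y)//= big1 ?addr0 => [|y' /eqP y'y].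
  congr (_ * _); rewrite !indicE.
  have [Bz|Bz] := pselect (B z); first by rewrite !mem_set.
  by rewrite !memNset// => -[].
by rewrite indicE memNset ?mul0r// => -[_ /= /y'y].
Qed.

End JointMeasure.

(** * Metric properties of the Euclidean cost *)

(** Expanding the sum of the squares of [B * a i - C * b i] gives [B * (A * B - C ^+ 2)]; one
    divides by [B] unless it is 0, in which case all [b i] vanish. *)
Lemma cauchy_schwarz_sum (F : realFieldType) (I : finType) (a b : I -> F) :
  (\sum_i a i * b i) ^+ 2 <= (\sum_i a i ^+ 2) * (\sum_i b i ^+ 2).
Proof.
set A := \sum_i a i ^+ 2; set B := \sum_i b i ^+ 2; set C := \sum_i a i * b i.
have B0 : 0 <= B by apply: sumr_ge0 => i _; exact: sqr_ge0.
have : 0 <= \sum_i (B * a i - C * b i) ^+ 2 by apply: sumr_ge0 => i _; exact: sqr_ge0.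
have -> : \sum_i (B * a i - C * b i) ^+ 2 = B * (A * B - C ^+ 2).
  rewrite (_ : B * _ = B ^+ 2 * A - 2 * B * C * C + C ^+ 2 * B); last by ring.
  have -> : B ^+ 2 * A = \sum_i B ^+ 2 * a i ^+ 2 by rewrite mulr_sumr.
  have -> : 2 * B * C * C = \sum_i 2 * B * C * (a i * b i) by rewrite -mulr_sumr.
  have -> : C ^+ 2 * B = \sum_i C ^+ 2 * b i ^+ 2 by rewrite -mulr_sumr.
  by rewrite -sumrB -big_split /=; apply: eq_bigr => i _; ring.
move: B0; rewrite le_eqVlt => /predU1P[B0 _|B0]; last by rewrite pmulr_rge0// subr_ge0.
have b0 i : b i = 0.
  apply/eqP; rewrite -sqrf_eq0; apply/eqP; apply/(psumr_eq0P _ (esym B0)) => // j _.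
  exact: sqr_ge0.
by rewrite /C big1 ?expr0n ?mulr0 -?B0 ?mulr0// => i _; rewrite b0 mulr0.
Qed.

Lemma minkowski_sum (R : rcfType) (I : finType) (a b : I -> R) :
  Num.sqrt (\sum_i (a i + b i) ^+ 2) <=
  Num.sqrt (\sum_i a i ^+ 2) + Num.sqrt (\sum_i b i ^+ 2).
Proof.
have S0 (f : I -> R) : 0 <= \sum_i f i ^+ 2 by apply: sumr_ge0 => i _; exact: sqr_ge0.
rewrite -[leRHS]ger0_norm ?addr_ge0// -sqrtr_sqr ler_sqrt ?sqr_ge0//.
rewrite sqrrD !sqr_sqrtr//.
under eq_bigr => i _ do rewrite sqrrD.
rewrite !big_split /= -mulr2n lerD2r lerD2l lerMn2r /= -sqrtrM//.
rewrite (le_trans (ler_norm _))// -sqrtr_sqr ler_wsqrtr//.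
exact: cauchy_schwarz_sum.
Qed.

Section Ecost.
Variables (R : realType) (d k : nat).
Implicit Types p q r : Euc R d * Euc R k.

Lemma ecost_ge0 p q : 0 <= ecost p q.
Proof. exact: sqrtr_ge0. Qed.

Lemma ecostC p q : ecost p q = ecost q p.
Proof.
by rewrite /ecost; congr (Num.sqrt (_ + _)); apply: eq_bigr => i _; rewrite -sqrrN opprB.
Qed.

Lemma ecost_triangle p q r : ecost p r <= ecost p q + ecost q r.
Proof.
(* Both coordinate blocks are read as one vector indexed by a sum type, so a single use of
   Minkowski's inequality suffices. *)
pose D (p q : Euc R d * Euc R k) (s : 'I_d + 'I_k) : R :=
  match s with inl i => p.1 ord0 i - q.1 ord0 i | inr j => p.2 ord0 j - q.2 ord0 j end.
have DE p' q' : ecost p' q' = Num.sqrt (\sum_s D p' q' s ^+ 2).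
  by rewrite /ecost big_sumType.
rewrite !DE (le_trans _ (minkowski_sum _ _ _ _))// le_eqVlt; apply/orP; left; apply/eqP.
by congr Num.sqrt; apply: eq_bigr => -[i|j] _ /=; congr (_ ^+ 2); ring.
Qed.

(** Serves to make the diameter positive as soon as two distinct labels occur. *)
Lemma ecost_gt0 (z : Euc R d) (y y' : Euc R k) : y != y' -> 0 < ecost (z, y) (z, y').
Proof.
move=> /eqP yy'; rewrite lt_neqAle ecost_ge0 andbT eq_sym /ecost /=.
apply/negP; rewrite sqrtr_eq0 big1 ?add0r => [h|i _]; last by rewrite subrr expr0n.
apply: yy'; apply/rowP => j; apply/eqP; rewrite -subr_eq0 -sqrf_eq0.
have S0 : \sum_(j < k) (y ord0 j - y' ord0 j) ^+ 2 = 0.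
  by apply/le_anti; rewrite h sumr_ge0// => i _; exact: sqr_ge0.
by apply/eqP; apply/(psumr_eq0P _ S0) => // i _; exact: sqr_ge0.
Qed.

End Ecost.

(** * Discretisation: finite minima, small cells and step functions *)

Lemma measurable_finite_min d (T : measurableType d) (R : realType) (I : finType)
    (i0 : I) (f : I -> T -> R) :
  (forall i, measurable_fun setT (f i)) ->
  exists phi : T -> R, [/\ measurable_fun setT phi,
    forall x, exists i, phi x = f i x & forall x i, phi x <= f i x].
Proof.
move=> mf.
(* The seed [i0] lets the induction start from a nonempty list; as a member of [I] it does not
   change the minimum. *)
suff [phi [mphi ex phile]] : exists phi : T -> R, [/\ measurable_fun setT phi,
    forall x, exists i, phi x = f i x & forall x i, i \in i0 :: enum I -> phi x <= f i x].
  by exists phi; split => // x i; apply: phile; rewrite inE mem_enum orbT.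
elim: (enum I) => [|j s [phi [mphi ex phile]]].
  exists (f i0); split => // x; first by exists i0.
  by move=> i; rewrite inE => /eqP ->.
exists (fun x => Num.min (phi x) (f j x)); split.
- exact: measurable_minr.
- move=> x; rewrite minEle; case: ifPn => _; first exact: ex.
  by exists j.
- move=> x i; rewrite !inE ge_min => /or3P[i0i|/eqP ->|is_].
  + by rewrite phile// inE i0i.
  + by rewrite lexx orbT.
  + by rewrite phile// inE is_ orbT.
Qed.

(** A finite subcover by interiors of balls, intersected with [Z] and made disjoint. The centres may
    lie outside [Z], which is harmless because the cost is defined on the whole space. *)
Lemma compact_partition (R : realType) (d : nat) (Z : set (Euc R d)) (e : R) :
  measurable Z -> @compact 'rV[R]_d Z -> 0 < e ->
  exists (n : nat) (x : 'I_n -> Euc R d) (B : 'I_n -> set (Euc R d)),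
  [/\ forall i, measurable (B i), trivIset setT B,
      forall z, Z z <-> exists i, B i z &
      forall i z, B i z -> \sum_j (z ord0 j - x i ord0 j) ^+ 2 <= e ^+ 2].
Proof.
move=> mZ; rewrite compact_cover => cZ e0.
(* Balls are taken in the sup norm, so the squared distance is at most [d * r ^+ 2], below [e ^+ 2];
   using [d.+1] avoids a zero divisor when [d = 0]. *)
pose r : R := e / d.+1%:R.
have r0 : 0 < r by rewrite divr_gt0.
pose G (x : 'rV[R]_d) : set 'rV[R]_d := (ball x r)^°.
have [|z Zz|s0 _ Zs0] := cZ _ setT G; first by move=> x _; exact: open_interior.
  by exists z => //; exact: nbhsx_ballx.
pose s : seq 'rV[R]_d := finmap.enum_fset s0.
have Zs z : Z z -> exists2 x, x \in s & G x z.
  by move=> /Zs0[x xs Gx]; exists x.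
(* Padding with empty sets turns the finite cover into a sequence, the format that [seqDU] makes
   disjoint. *)
pose F n : set (Euc R d) :=
  Z `&` (if (n < size s)%N then G (nth 0 s n) else set0).
have mF n : measurable (F n).
  apply: measurableI => //; case: ifP => // _.
  by apply: sub_sigma_algebra; exact: open_interior.
exists (size s), (fun i => nth 0 s i), (fun i => seqDU F i); split.
- by move=> i; exact: seqDU_measurable.
- apply/trivIsetP => i j _ _ ij; have /trivIsetP := trivIset_seqDU F; apply => //.
- move=> z; split => [Zz|[i Bi]]; last by have [] : F i z by exact: subset_seqDU Bi.
  have [x xs Gx] := Zs _ Zz.
  have : (\bigcup_k F k) z.
    exists (index x s) => //; split => //.
    by rewrite index_mem xs nth_index.
  rewrite seqDU_bigcup_eq => -[n _ Fn].
  have ns : (n < size s)%N.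
    by have [_] : F n z by [exact: subset_seqDU Fn]; case: ifP.
  by exists (Ordinal ns).
- move=> i z Bi; have [_] : F i z by exact: subset_seqDU Bi.
  rewrite ltn_ord => /interior_subset Gz.
  have zr j : (z ord0 j - nth 0 s i ord0 j) ^+ 2 <= r ^+ 2.
    have [_ /(_ ord0 j) zj] := Gz; rewrite /ball /= in zj.
    by rewrite -ler_sqrt ?sqr_ge0// !sqrtr_sqr distrC [leRHS]ger0_norm ltW.
  apply: (le_trans (ler_sum _ (fun j _ => zr j))).
  rewrite sumr_const card_ord -mulr_natr.
  have -> : e = r * d.+1%:R by rewrite /r divfK.
  rewrite [leRHS]exprMn ler_wpM2l ?sqr_ge0// -natrX ler_nat.
  by rewrite (leq_trans (leqnSn d))// leq_pmulr.
Qed.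

(** [p] lives on the cells, where [h] dominates the step function with values [w]. The bound [M]
    makes [h * p] integrable, so that such inequalities can later be subtracted. *)
Lemma integral_ge_step d (T : measurableType d) (R : realType)
    (mu : {measure set T -> \bar R}) (p h : T -> R) (n : nat)
    (B : 'I_n -> set T) (w : 'I_n -> R) (M : R) :
  measurable_fun setT p -> measurable_fun setT h -> (forall z, 0 <= p z) ->
  mu.-integrable setT (EFin \o p) ->
  (forall i, measurable (B i)) -> trivIset setT B ->
  (forall z, p z != 0 -> exists i, B i z) ->
  (forall i z, B i z -> w i <= h z /\ `|h z| <= M) ->
  mu.-integrable setT (fun z => (h z * p z)%:E) /\
  (\sum_i (w i)%:E * \int[mu]_z (\1_(B i) z * p z)%:E <= \int[mu]_z (h z * p z)%:E)%E.
Proof.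
move=> mp mh p0 ip mB tB pB wh.
(* The bound on [g] is required only where [p] is nonzero, since [h] is controlled on the cells
   alone. *)
have dom (g : T -> R) (N : R) : measurable_fun setT g ->
    (forall z, p z != 0 -> `|g z| <= N) ->
    mu.-integrable setT (fun z => (g z * p z)%:E).
  move=> mg gN; apply: (@le_integrable _ _ _ _ _ measurableT _ (fun z => N%:E * (EFin \o p) z)%E).
  - by apply/measurable_EFinP; exact: measurable_funM.
  - move=> z _ /=; rewrite lee_fin !normrM; have [->|pz] := eqVneq (p z) 0.
      by rewrite !normr0 !mulr0.
    by rewrite ler_wpM2r// (le_trans (gN _ pz))// ler_norm.
  - exact: integrableZl.
have ihp : mu.-integrable setT (fun z => (h z * p z)%:E).
  by apply: (dom _ M) => // z /pB[i /wh[]].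
split => //.
have i1 i : mu.-integrable setT (fun z => (\1_(B i) z * p z)%:E).
  apply: (dom _ 1) => [|z _]; first exact: measurable_indic.
  by rewrite indicE ger0_norm// lern1 leq_b1.
under eq_bigr => i _ do rewrite -(integralZl measurableT (i1 i)).
rewrite -integral_sum//; last by move=> i; exact: integrableZl.
apply: le_integral => //.
  by apply: integrable_sum => // i _; exact: integrableZl.
move=> z _ /=; rewrite -(big_mkcond xpredT) /=.
under eq_bigr => i _ do rewrite -EFinM.
rewrite sumEFin lee_fin; have [pz|/pB[i Bi]] := eqVneq (p z) 0.
  by rewrite pz mulr0 big1// => i _; rewrite !mulr0.
rewrite (bigD1 i)//= big1 ?addr0 => [|j ji].
  by rewrite indicE mem_set// mul1r ler_wpM2r//; have [] := wh _ _ Bi.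
rewrite indicE memNset ?mul0r ?mulr0// => Bj.
by have /trivIsetP/(_ j i Logic.I Logic.I ji) := tB; move/seteqP => [/(_ z)] /(_ (conj Bj Bi)).
Qed.

(** * Kantorovich duality against label-wise suprema *)

Section Duality.
Variables (R : realType) (d k : nat) (Z : set (Euc R d)) (Ys : seq (Euc R k)).
Variable mu : {measure set (Euc R d) -> \bar R}.
Implicit Types (p q : Euc R d -> Euc R k -> R).

Lemma is_density_out p z y : is_density mu Z Ys p -> y \in Ys -> p z y != 0 -> Z z.
Proof.
by case=> _ _ p0 _ yY pz; apply: contrapT => nZ; move: pz; rewrite p0// eqxx.
Qed.

Lemma Wcheck_ge0 p q y : (0 <= Wcheck mu Z Ys p q y)%E.
Proof.
apply: ereal_sup_ubound; exists (fun _ _ => 0); split.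
  by move=> *; rewrite subrr normr0 ecost_ge0.
by rewrite /EZ !integral0_eq ?sube0// => z _; rewrite mul0r mule0.
Qed.

(** The marginal times the conditional is the joint density, and the restriction to [Z] costs
    nothing since the density vanishes off [Z]. *)
Lemma EZ_cond p (phi : Euc R d -> R) y : is_density mu Z Ys p -> y \in Ys ->
  EZ mu Z Ys p (fun z => (phi z * cond Ys p z y)%:E) = (\int[mu]_z (phi z * p z y)%:E)%E.
Proof.
move=> dp yY; rewrite /EZ integral_mkcond; apply: eq_integral => z _.
rewrite patchE; case: ifPn => [_|]; last first.
  rewrite notin_setE => nZ; congr _%:E; apply/esym/eqP; rewrite mulf_eq0; apply/orP; right.
  by apply: contrapT => /negP/(is_density_out _ _ _ dp yY).
case: dp => _ p0 _ _; rewrite -EFinM; congr _%:E; rewrite /cond.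
(* Where the marginal vanishes, [cond] is the junk value [0 / 0 = 0], and so is [p]. *)
have [m0|m0] := eqVneq (marg Ys p z) 0; last by field.
rewrite m0 mul0r; apply/esym/eqP; rewrite mulf_eq0; apply/orP; right.
move/eqP: m0; rewrite /marg big_seq psumr_eq0 => [/allP/(_ _ yY)|y' y'Y]; last exact: p0.
by rewrite yY.
Qed.

Lemma integrable_density p y : is_density mu Z Ys p -> y \in Ys ->
  mu.-integrable setT (EFin \o p^~ y).
Proof.
case=> mp p0 _ p1 yY; apply/integrableP; split; first by apply/measurable_EFinP; exact: mp.
apply: (@le_lt_trans _ _ (\int[mu]_z (\sum_(y <- Ys) p z y)%:E)%E); last by rewrite p1 ltry.
apply: ge0_le_integral => //.
- by apply: measurableT_comp => //; apply/measurable_EFinP; exact: mp.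
- by apply/measurable_EFinP; apply: measurable_sum_seq.
- move=> z _ /=; rewrite lee_fin ger0_norm ?p0//.
  rewrite (big_rem y)//= lerDl big_seq sumr_ge0// => y' /mem_rem; exact: p0.
Qed.

Lemma W1_le_Wcheck p q :
  measurable Z -> @compact 'rV[R]_d Z -> uniq Ys ->
  is_density mu Z Ys p -> is_density mu Z Ys q ->
  (W1 mu Ys p q <= \sum_(y <- Ys) Wcheck mu Z Ys p q y)%E.
Proof.
move=> mZ cZ uY dp dq.
set S := (\sum_(y <- Ys) _)%E.
have S0 : (0 <= S)%E by apply: sume_ge0 => y _; exact: Wcheck_ge0.
have [->|Sfin] := eqVneq S +oo%E; first exact: leey.
have {S0 Sfin} SD : S = (fine S)%:E by rewrite fineK// ge0_fin_numE// ltey.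
set D := fine S in SD.
apply/lee_addgt0Pr => e e0; rewrite SD -EFinD.
(* The dual estimate loses [2 * eps] and the spreading of the plan over cells loses another
   [2 * eps]. *)
pose eps := e / 4; have eps0 : 0 < eps by rewrite divr_gt0.
have [n [x [B [mB tB ZB xB]]]] := compact_partition _ _ _ eps mZ cZ eps0.
pose I := ('I_n * 'I_(size Ys))%type.
pose ys (m : 'I_(size Ys)) : Euc R k := nth point Ys m.
have ysY m : ys m \in Ys by exact: mem_nth.
pose pt (i : I) : Euc R d * Euc R k := (x i.1, ys i.2).
pose A (i : I) : set (Euc R d * Euc R k) := B i.1 `*` [set ys i.2].
pose K : set (Euc R d * Euc R k) := Z `*` [set` Ys].
have mY1 y : measurable [set y : Euc R k].
  exact: (measurable_eqEuc _ _ _ _ id y (@measurable_id _ _ _)).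
have mA i : measurable (A i) by exact: measurableX.
have mK : measurable K by apply: measurableX => //; exact: measurable_seq.
have tA : trivIset setT A.
  apply/trivIsetP => -[i m] [j m'] _ _ ij; apply/seteqP; split => // -[z y] [[/= Bi ->] [/= Bj ym]].
  move/eqP : ij; apply; congr pair.
    apply/eqP; apply: contrapT => /negP ij.
    have /trivIsetP/(_ i j Logic.I Logic.I ij) Bij := tB.
    by have : (B i `&` B j) z by []; rewrite Bij.
  by apply/val_inj/eqP; rewrite -(nth_uniq point (ltn_ord m) (ltn_ord m') uY); apply/eqP.
have KA w : K w -> exists i, A i w.
  case: w => z y [/= /ZB[i Bi] yY].
  have sy : (index y Ys < size Ys)%N by rewrite index_mem.
  by exists (i, Ordinal sy); split => //=; rewrite /ys /= nth_index.
have Aeps i w : A i w -> ecost w (pt i) <= eps.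
  case: w => z y [/= Bi ->]; rewrite /ecost /= [X in _ + X]big1 ?addr0; last first.
    by move=> j _; rewrite subrr expr0n.
  by rewrite -(ger0_norm (ltW eps0)) -sqrtr_sqr ler_wsqrtr// xB.
have [P PE] := jointm_probability _ _ _ _ _ _ _ dp.
have [Q QE] := jointm_probability _ _ _ _ _ _ _ dq.
have PK : P (~` K) = 0%E by rewrite PE (jointm_outside _ _ _ _ _ _ _ dp).
have QK : Q (~` K) = 0%E by rewrite QE (jointm_outside _ _ _ _ _ _ _ dq).
(* [P] gives [K] full mass, so [K] has a point and some cell exists; this index seeds the finite
   minimum below. *)
have [i0 _] : exists i : I, true.
  have [[w Kw]|/forallNP nK] := pselect (exists w, K w).
    by have [i _] := KA _ Kw; exists i.
  have K0 : ~` K = setT by rewrite -subTset => w _; exact: nK.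
  by move: PK; rewrite K0 probability_setT => /eqP; rewrite onee_eq0.
have sum1 (M : probability (Euc R d * Euc R k)%type R) : M (~` K) = 0%E ->
    \sum_i fine (M (A i)) = 1.
  move=> MK; apply: EFin_inj; rewrite -sumEFin.
  rewrite -(probability_setT M) (probability_partition _ _ _ M _ A K setT)//.
  by apply: eq_bigr => i _; rewrite setTI fineK// fin_num_measure.
have Pfin i : (fine (P (A i)))%:E = P (A i) by rewrite fineK// fin_num_measure.
have Qfin i : (fine (Q (A i)))%:E = Q (A i) by rewrite fineK// fin_num_measure.
have [u v uv|l [l0 lP lQ lD]] := finite_kantorovich R I
    (fun i j => ecost (pt i) (pt j)) (fun i => fine (P (A i)))
    (fun i => fine (Q (A i))) (D + 2 * eps) (fun i j => ecost_ge0 _ _ _ _ _).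
  (* [phi] is the c-transform of [v]; as a minimum of translates of the cost it is 1-Lipschitz in
     the point and the label jointly. *)
  have [|phi [mphi ex phile]] := measurable_finite_min _ (Euc R d * Euc R k)%type R I i0
      (fun i w => v i + ecost w (pt i)).
    move=> i; apply: measurable_funD; first exact: measurable_cst.
    by apply: measurable_ecost => //; exact: measurable_cst.
  have philip w w' : phi w - phi w' <= ecost w w'.
    have [i ->] := ex w'; have := phile w i.
    have := ecost_triangle _ _ _ w w' (pt i); lra.
  have lphi : lip1 Z Ys (fun z y => phi (z, y)).
    move=> z z' y y' _ _ _ _; rewrite ler_norml philip andbT lerNl opprB.
    by rewrite ecostC philip.
  (* The upper bound takes index [i] in the minimum. The lower bound combines feasibility of
     [(u, v)] at the minimising index with the triangle inequality. *)
  have phiA i w : A i w -> u i - eps <= phi w <= v i + eps.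
    move=> Aw; have := Aeps _ _ Aw; have := phile w i.
    have [j ->] := ex w; have := uv i j; have := ecost_triangle _ _ _ (pt i) w (pt j).
    by rewrite (ecostC _ _ _ (pt i) w) => *; apply/andP; split; lra.
  pose M := \sum_i (`|u i| + `|v i| + eps).
  have phiM i w : A i w -> `|phi w| <= M.
    move=> /phiA /andP[h1 h2]; rewrite /M (bigD1 i)//= ler_wpDr//.
      by apply: sumr_ge0 => j _; rewrite !addr_ge0// ltW.
    have := ler_norm (v i); have := ler_norm (- u i); rewrite normrN.
    have := normr_ge0 (u i); have := normr_ge0 (v i).
    by rewrite ler_norml => *; apply/andP; split; lra.
  have mphiy y : measurable_fun setT (fun z => phi (z, y)).
    apply: (measurableT_comp mphi).
    apply: (@measurable_fun_pair _ _ _ _ _ _ id (cst y)).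
      exact: measurable_id.
    exact: measurable_cst.
  have pB r (dr : is_density mu Z Ys r) m z : r z (ys m) != 0 -> exists i, B i z.
    by move=> /(is_density_out _ _ _ dr (ysY m)) /ZB.
  have slice r (dr : is_density mu Z Ys r) i m :
      jointm mu Ys r (A (i, m)) = (\int[mu]_z (\1_(B i) z * r z (ys m))%:E)%E.
    by rewrite (jointm_slice _ _ _ _ _ _ _ _ uY (ysY m)).
  have step r (dr : is_density mu Z Ys r) (h : Euc R d * Euc R k -> R) (w : I -> R) m :
      measurable_fun setT (fun z => h (z, ys m)) ->
      (forall i a, A i a -> w i <= h a /\ `|h a| <= M) ->
      mu.-integrable setT (fun z => (h (z, ys m) * r z (ys m))%:E) /\
      (\sum_i (w (i, m))%:E * jointm mu Ys r (A (i, m))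
        <= \int[mu]_z (h (z, ys m) * r z (ys m))%:E)%E.
    move=> mh wh; under eq_bigr => i _ do rewrite slice//.
    apply: (integral_ge_step _ _ _ _ _ (fun z => h (z, ys m)) _ _ _ M) => //.
    - by case: dr => + _ _ _; exact.
    - by move=> z; case: dr => _ + _ _; exact.
    - exact: integrable_density.
    - exact: pB.
    - by move=> i z Bi; apply: (wh (i, m)).
  (* The slice of [phi] at one label competes in the supremum for that label; [step] compares its
     integrals with the cell sums. *)
  have lower m : ((\sum_i (u (i, m) - eps) * fine (P (A (i, m)))
       - \sum_i (v (i, m) + eps) * fine (Q (A (i, m))))%R%:E
      <= Wcheck mu Z Ys p q (ys m))%E.
    have [ip hp] := step p dp phi (fun i => u i - eps) m (mphiy _)
      (fun i a Aa => conj (proj1 (andP (phiA i a Aa))) (phiM i a Aa)).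
    have [iq _] := step q dq phi (fun i => u i - eps) m (mphiy _)
      (fun i a Aa => conj (proj1 (andP (phiA i a Aa))) (phiM i a Aa)).
    (* The integral against [q] must be bounded from above, hence [step] is applied to [- phi]. *)
    have [|i a Aa|_ hq] := step q dq (fun a => - phi a) (fun i => - (v i + eps)) m.
    - by apply: measurableT_comp => //; exact: mphiy.
    - by rewrite normrN lerN2 (phiM i)//; split => //; have /andP[] := phiA _ _ Aa.
    have {}hq : (\sum_i (- (v (i, m) + eps))%:E * jointm mu Ys q (A (i, m))
        <= (- 1)%:E * \int[mu]_z (phi (z, ys m) * q z (ys m))%:E)%E.
      rewrite -integralZl//; apply: (le_trans hq); rewrite le_eqVlt; apply/orP; left; apply/eqP.
      by apply: eq_integral => z _; rewrite -EFinM mulN1r mulNr.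
    apply: (@le_trans _ _ (\int[mu]_z (phi (z, ys m) * p z (ys m))%:E
                           - \int[mu]_z (phi (z, ys m) * q z (ys m))%:E)%E).
      move: (integrable_fin_num measurableT ip) (integrable_fin_num measurableT iq) hp hq.
      case: (integral _ _ _) => [a||] // _; case: (integral _ _ _) => [b||] // _.
      under eq_bigr => i _ do rewrite -PE -Pfin -EFinM.
      rewrite sumEFin lee_fin => hp.
      under eq_bigr => i _ do rewrite -QE -Qfin -EFinM mulNr.
      rewrite sumEFin sumrN -EFinM -EFinB !lee_fin => hq; lra.
    apply: ereal_sup_ubound; exists (fun z y => phi (z, y)); split => //.
    rewrite (EZ_cond p (fun z => phi (z, ys m)) _ dp (ysY m)).
    by rewrite (EZ_cond q (fun z => phi (z, ys m)) _ dq (ysY m)).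
  have SE : S = (\sum_(m < size Ys) Wcheck mu Z Ys p q (ys m))%E.
    by rewrite /S (big_nth point) big_mkord.
  (* Summing over labels restores the full dual value; as the cell masses of [P] and of [Q] each sum
     to 1, the total error is [2 * eps]. *)
  have := lee_sum (index_enum 'I_(size Ys)) (fun m (_ : true) => lower m).
  rewrite sumEFin -SE SD lee_fin sumrB.
  rewrite exchange_big [X in _ - X]exchange_big /= !pair_bigA /=.
  have -> : \sum_(i : I) (u (i.1, i.2) - eps) * fine (P (A (i.1, i.2))) =
      \sum_i u i * fine (P (A i)) - eps.
    under eq_bigr => i _ do rewrite -surjective_pairing mulrBl.
    by rewrite sumrB -mulr_sumr sum1// mulr1.
  have -> : \sum_(i : I) (v (i.1, i.2) + eps) * fine (Q (A (i.1, i.2))) =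
      \sum_i v i * fine (Q (A i)) + eps.
    under eq_bigr => i _ do rewrite -surjective_pairing mulrDl.
    by rewrite big_split /= -mulr_sumr sum1// mulr1.
  by move=> *; lra.
have lP' i : (\sum_j l i j)%:E = P (A i) by rewrite lP Pfin.
have lQ' j : (\sum_i l i j)%:E = Q (A j) by rewrite lQ Qfin.
have mc : measurable_fun setT
    (fun w : (Euc R d * Euc R k) * (Euc R d * Euc R k) => ecost w.1 w.2).
  by apply: measurable_ecost; [exact: measurable_fst|exact: measurable_snd].
have b0 i j : 0 <= ecost (pt i) (pt j) + 2 * eps.
  by rewrite addr_ge0 ?ecost_ge0 ?mulr_ge0// ltW.
have cb i j a b : A i a -> A j b -> ecost a b <= ecost (pt i) (pt j) + 2 * eps.
  move=> /Aeps h1 /Aeps; rewrite ecostC => h2.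
  have := ecost_triangle _ _ _ a (pt i) b; have := ecost_triangle _ _ _ (pt i) (pt j) b.
  by move=> *; lra.
have [pi [piM piC]] := coupling_of_plan _ _ R P Q I A K l _ _
  mA tA mK PK QK KA l0 lP' lQ' mc (fun w => ecost_ge0 _ _ _ w.1 w.2) b0 cb.
apply: (@le_trans _ _ (\int[pi]_w (ecost w.1 w.2)%:E)%E).
  apply: ereal_inf_lbound; exists pi; split => // C mC.
  by rewrite -PE -QE; exact: piM.
apply: (le_trans piC); rewrite lee_fin.
under eq_bigr => i _.
  under eq_bigr => j _ do rewrite mulrDr.
  rewrite big_split /= -mulr_suml lP; over.
rewrite big_split /= -mulr_suml sum1// mul1r.
by move: lD; rewrite /eps; lra.
Qed.

End Duality.

(** * Deterministic labels: the set where they fail and the resulting KL dichotomy *)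

Section LabelledDensity.
Variables (R : realType) (d k : nat) (Z : set (Euc R d)) (Ys : seq (Euc R k)).
Variables (mu : {measure set (Euc R d) -> \bar R}) (p : Euc R d -> Euc R k -> R).
Variables (f : Euc R d -> Euc R k) (a : R).
Hypotheses (mZ : measurable Z) (uY : uniq Ys) (dp : is_density mu Z Ys p).
Hypotheses (mf : measurable_fun setT f) (fY : forall z, Z z -> f z \in Ys).
Hypothesis (a01 : 0 < a < 1).
Local Notation pf := (labdens Ys p f).
Local Notation P := (mix a p pf).

Lemma measurable_label y : measurable_fun setT (fun z => (f z == y)%:R : R).
Proof.
rewrite (_ : (fun z => _) = \1_[set z | f z = y]).
  by apply: measurable_indic; exact: measurable_eqEuc.
rewrite funeqE => z; rewrite indicE; case: eqP => fz; first by rewrite mem_set.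
by rewrite memNset.
Qed.

Lemma measurable_marg : measurable_fun setT (marg Ys p).
Proof. by case: dp => mp _ _ _; exact: measurable_sum_seq. Qed.

Lemma marg_ge0 z : 0 <= marg Ys p z.
Proof. by case: dp => _ p0 _ _; rewrite /marg big_seq sumr_ge0// => y; exact: p0. Qed.

Lemma marg_out z : ~ Z z -> marg Ys p z = 0.
Proof.
by move=> nZ; case: dp => _ _ p0 _; rewrite /marg big_seq big1// => y yY; exact: p0.
Qed.

(** For [z] in [Z] the label [f z] occurs exactly once in the duplicate-free [Ys]; elsewhere both
    sides vanish. *)
Lemma marg_labdens z : marg Ys pf z = marg Ys p z.
Proof.
rewrite {1}/marg /labdens -mulr_sumr.
have [Zz|/marg_out ->] := pselect (Z z); last by rewrite mul0r.
rewrite (bigD1_seq (f z))//= ?fY// eqxx big1 ?addr0 ?mulr1// => y /negPf.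
by rewrite eq_sym => ->.
Qed.

Lemma marg_mix z : marg Ys P z = marg Ys p z.
Proof.
rewrite {1}/marg /mix big_split /= -mulr_sumr -mulr_sumr.
by rewrite -[X in _ + _ * X]/(marg Ys pf z) marg_labdens -/(marg Ys p z); ring.
Qed.

Lemma density_mix : is_density mu Z Ys P.
Proof.
have [a0 a1] := andP a01; case: (dp) => mp p0 pout p1; split.
- move=> y yY; apply: measurable_funD; apply: measurable_funM.
  + exact: measurable_cst.
  + exact: mp.
  + exact: measurable_cst.
  + by apply: measurable_funM; [exact: measurable_marg|exact: measurable_label].
- move=> z y yY; apply: addr_ge0; apply: mulr_ge0.
  + exact: ltW.
  + exact: p0.
  + by rewrite subr_ge0 ltW.
  + by apply: mulr_ge0; [exact: marg_ge0|exact: ler0n].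
- by move=> z y yY nZ; rewrite /mix /labdens pout// marg_out// mul0r !mulr0 addr0.
- by rewrite -p1; apply: eq_integral => z _; congr _%:E; exact: marg_mix.
Qed.

(** Encoded as the support of one finite sum, so that measurability is inherited from that of a real
    function. *)
Definition mislabelled : set (Euc R d) :=
  [set z | \sum_(y <- Ys) p z y * (f z != y)%:R != 0].

Lemma measurable_mislabelled : measurable mislabelled.
Proof.
have mg : measurable_fun setT (fun z => \sum_(y <- Ys) p z y * (f z != y)%:R).
  apply: measurable_sum_seq => y yY; apply: measurable_funM.
    by case: dp => mp _ _ _; exact: mp.
  rewrite (_ : (fun z => _) = (fun z => 1 - (f z == y)%:R)); last first.
    by rewrite funeqE => z; case: eqP; rewrite /= ?subrr ?subr0.
  by apply: measurable_funB; [exact: measurable_cst|exact: measurable_label].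
have := mg measurableT _ (measurableC (measurable_set1 0)); rewrite setTI.
by congr (measurable _); apply/seteqP; split => z /=; [move/eqP|move=> /eqP].
Qed.

Lemma mislabelledP z : mislabelled z <->
  exists2 y, y \in Ys & (f z != y) && (p z y != 0).
Proof.
case: dp => _ p0 _ _; rewrite /mislabelled /= big_seq psumr_neq0; last first.
  by move=> y yY; rewrite mulr_ge0// p0.
split=> [/hasP[y yY]|[y yY /andP[fy py]]].
  rewrite yY /= => py; exists y => //; move: py; case: (f z != y) => /=.
    by rewrite mulr1 => /lt0r_neq0.
  by rewrite mulr0 ltxx.
apply/hasP; exists y => //; rewrite yY /= fy mulr1 lt_neqAle eq_sym py.
exact: p0.
Qed.

Lemma mislabelled_sub : mislabelled `<=` Z.
Proof. by move=> z /mislabelledP[y yY /andP[_]]; exact: (is_density_out _ _ _ _ _ _ _ _ _ dp yY). Qed.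

(** At such a point no label other than [f z] is charged, so the whole marginal sits on [f z]. *)
Lemma well_labelled z y : ~ mislabelled z -> y \in Ys -> p z y = pf z y.
Proof.
move=> nz yY; have p0 y' : y' \in Ys -> f z != y' -> p z y' = 0.
  move=> y'Y fy'; apply/eqP; apply: contrapT => /negP py'; apply: nz.
  by apply/mislabelledP; exists y' => //; rewrite fy' py'.
rewrite /labdens; have [fy|fy] := eqVneq (f z) y; last by rewrite mulr0 p0.
rewrite mulr1 /marg (bigD1_seq y)//= big_seq_cond big1 ?addr0// => y' /andP[y'Y y'y].
by rewrite p0// fy eq_sym.
Qed.

(** One charged label different from [f z] has conditional probability 0 under [pf] and contributes
    [+oo]. Otherwise, if the marginal is nonzero, both conditionals are the point mass at [f z]; a
    zero marginal kills the product. *)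
Lemma KLfin_labdens z : Z z ->
  ((marg Ys p z)%:E * KLfin Ys (cond Ys p z) (cond Ys pf z))%E =
  (cst +oo \_ mislabelled)%E z.
Proof.
move=> Zz; case: (dp) => _ p0 _ _.
have condf y : marg Ys p z != 0 -> cond Ys pf z y = (f z == y)%:R.
  by move=> m0; rewrite /cond marg_labdens /labdens mulrAC mulfV// mul1r.
rewrite patchE; case: ifPn => [|]; rewrite (inE, notin_setE) => bz.
  have [y yY /andP[fy py]] := (mislabelledP z).1 bz.
  have m0 : 0 < marg Ys p z.
    rewrite lt_neqAle marg_ge0 andbT eq_sym; apply: contra_neq py.
    move=> /eqP; rewrite /marg big_seq psumr_eq0 => [/allP/(_ _ yY)|y' y'Y]; last exact: p0.
    by rewrite yY => /eqP.
  suff -> : KLfin Ys (cond Ys p z) (cond Ys pf z) = +oo%E by rewrite gt0_muley ?lte_fin.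
  apply/esum_eqyP.
    by move=> y' _; rewrite /klterm; case: ifP => // _; case: ifP.
  have cf : cond Ys pf z y = 0 by rewrite condf ?(negPf fy)// gt_eqF.
  have cp : (cond Ys p z y == 0) = false.
    by rewrite /cond mulf_eq0 invr_eq0 (negPf py) gt_eqF.
  by exists y; split => //; rewrite /klterm cp cf eqxx.
have [->|m0] := eqVneq (marg Ys p z) 0; first by rewrite mul0e.
rewrite /KLfin big_seq big1 ?mule0// => y yY; rewrite condf//.
have -> : cond Ys p z y = (f z == y)%:R.
  by rewrite -condf// /cond marg_labdens (well_labelled _ _ bz).
by rewrite /klterm; case: (f z == y); rewrite ?eqxx// oner_eq0 divr1 ln1 mulr0.
Qed.

(** Mixing preserves the marginal, so the integrand is [+oo] on the mislabelled set and 0 elsewhere;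
    the convention [+oo * 0 = 0] handles a null set. *)
Lemma EZ_KL :
  EZ mu Z Ys P (fun z => KLfin Ys (cond Ys p z) (cond Ys pf z)) =
  (+oo * mu mislabelled)%E.
Proof.
transitivity (\int[mu]_(z in Z) (cst +oo \_ mislabelled) z)%E.
  by apply: eq_integral => z; rewrite inE marg_mix; exact: KLfin_labdens.
rewrite -integral_mkcondr integral_cst; last first.
  by apply: measurableI => //; exact: measurable_mislabelled.
by rewrite setIidr//; exact: mislabelled_sub.
Qed.

Definition KL_penalty : \bar R :=
  ((1 - a)%:E * diamZY Z Ys *
    sqrte (2^-1%:E * EZ mu Z Ys P (fun z => KLfin Ys (cond Ys p z) (cond Ys pf z))))%E.

Lemma KL_penalty0 : mu mislabelled = 0%E -> KL_penalty = 0%E.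
Proof. by move=> m0; rewrite /KL_penalty EZ_KL m0 !mule0 sqrte0 mule0. Qed.

(** The factor [+oo] survives only against positive factors: [1 - a] is positive, and a mislabelled
    point carries two distinct labels [f z] and [y], which makes the diameter positive. *)
Lemma KL_penaltyy : mu mislabelled != 0%E -> KL_penalty = +oo%E.
Proof.
move=> m0; have [a0 a1] := andP a01.
have [z bz] : mislabelled !=set0.
  by apply/set0P; apply: contra_neq m0 => ->; rewrite measure0.
have [y yY /andP[fy _]] := (mislabelledP z).1 bz.
have Zz := mislabelled_sub _ bz.
have diam0 : (0 < diamZY Z Ys)%E.
  apply: (@lt_le_trans _ _ (ecost (z, f z) (z, y))%:E); first by rewrite lte_fin ecost_gt0.
  by apply: ereal_sup_ubound; exists z, z, (f z), y; split => //; exact: fY.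
rewrite /KL_penalty EZ_KL gt0_mulye ?lt0e ?m0 ?measure_ge0// gt0_muley ?lte_fin//.
by rewrite /= gt0_muley// mule_gt0// lte_fin subr_gt0.
Qed.

(** Off the mislabelled set [p] equals [pf], hence also every mixture of the two. *)
Lemma jointm_mix A : measurable A -> mu mislabelled = 0%E ->
  jointm mu Ys p A = jointm mu Ys P A.
Proof.
move=> mA m0; apply: ge0_ae_eq_integral => //.
- by apply/measurable_EFinP; exact: (measurable_jointm_integrand _ _ _ _ _ _ _ dp).
- by apply/measurable_EFinP; exact: (measurable_jointm_integrand _ _ _ _ _ _ _ density_mix).
- by move=> z _; rewrite lee_fin (jointm_integrand_ge0 _ _ _ _ _ _ _ dp).
- by move=> z _; rewrite lee_fin (jointm_integrand_ge0 _ _ _ _ _ _ _ density_mix).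
exists mislabelled; split => //; first exact: measurable_mislabelled.
move=> z /= /not_implyP[_]; apply: contra_notP => nz; congr _%:E.
by apply: eq_big_seq => y yY; rewrite /mix -(well_labelled _ _ nz yY); ring.
Qed.

End LabelledDensity.

(** * Case analysis on the two mislabelled sets *)

Theorem theorem1 (R : realType) (d k : nat)
    (Z : set (Euc R d)) (Ys : seq (Euc R k))
    (mu : {measure set (Euc R d) -> \bar R})
    (pt qt : Euc R d -> Euc R k -> R) (f g : Euc R d -> Euc R k)
    (alpha beta : R) :
  measurable Z -> @compact 'rV[R]_d Z -> uniq Ys ->
  sigma_finite setT mu ->
  is_density mu Z Ys pt -> is_density mu Z Ys qt ->
  measurable_fun setT f -> (forall z, Z z -> f z \in Ys) ->
  measurable_fun setT g -> (forall z, Z z -> g z \in Ys) ->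
  0 < alpha < 1 -> 0 < beta < 1 ->
  let pf := labdens Ys pt f in
  let qf := labdens Ys qt g in
  let P := mix alpha pt pf in
  let Q := mix beta qt qf in
  (W1 mu Ys pt qt <=
     (1 - alpha)%:E * diamZY Z Ys *
       sqrte (2^-1%:E * EZ mu Z Ys P (fun z => KLfin Ys (cond Ys pt z) (cond Ys pf z)))
   + \sum_(y <- Ys) Wcheck mu Z Ys P Q y
   + (1 - beta)%:E * diamZY Z Ys *
       sqrte (2^-1%:E * EZ mu Z Ys Q (fun z => KLfin Ys (cond Ys qt z) (cond Ys qf z))))%E.
Proof.
move=> mZ cZ uY _ dp dq mf fY mg gY a01 b01; cbv zeta.
set S := (\sum_(y <- Ys) _)%E.
have S0 : (0 <= S)%E by apply: sume_ge0 => y _; exact: Wcheck_ge0.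
rewrite -/(KL_penalty R d k Z Ys mu pt f alpha) -/(KL_penalty R d k Z Ys mu qt g beta).
(* A non-null mislabelled set makes its penalty [+oo]; the nonnegativity of [S] excludes a
   cancelling [-oo] in the sum. *)
have [mp|mp] := eqVneq (mu (mislabelled R d k Ys pt f)) 0%E; last first.
  rewrite (KL_penaltyy _ _ _ _ _ _ _ _ _ mZ uY dp mf fY a01 mp).
  have [mq|mq] := eqVneq (mu (mislabelled R d k Ys qt g)) 0%E.
    by rewrite (KL_penalty0 _ _ _ _ _ _ _ _ _ mZ uY dq mg gY mq) adde0 addye ?leey// gt_eqF// (lt_le_trans _ S0).
  rewrite (KL_penaltyy _ _ _ _ _ _ _ _ _ mZ uY dq mg gY b01 mq).
  by rewrite addye ?leey// gt_eqF// (lt_le_trans _ S0).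
rewrite (KL_penalty0 _ _ _ _ _ _ _ _ _ mZ uY dp mf fY mp) add0e.
have [mq|mq] := eqVneq (mu (mislabelled R d k Ys qt g)) 0%E; last first.
  rewrite (KL_penaltyy _ _ _ _ _ _ _ _ _ mZ uY dq mg gY b01 mq).
  by rewrite addey ?leey// gt_eqF// (lt_le_trans _ S0).
rewrite (KL_penalty0 _ _ _ _ _ _ _ _ _ mZ uY dq mg gY mq) adde0.
apply: (le_trans _ (W1_le_Wcheck _ _ _ _ _ _ _ _ mZ cZ uY
  (density_mix _ _ _ _ _ _ _ _ _ uY dp mf fY a01)
  (density_mix _ _ _ _ _ _ _ _ _ uY dq mg gY b01))).
(* With both penalties 0, [pt] and [qt] have the same joint laws as their mixtures, so every
   coupling of the mixtures couples the true distributions. *)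
apply: le_ereal_inf => _ [pi [piM ->]]; exists pi; split => // A mA.
rewrite (jointm_mix _ _ _ _ _ _ _ _ _ uY dp mf fY a01 _ mA mp).
rewrite (jointm_mix _ _ _ _ _ _ _ _ _ uY dq mg gY b01 _ mA mq).
exact: piM.
Qed.
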